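(* Suppose that $F$ is $\alpha$-fat for some $\alpha>0$. Let $h_N=\Theta(\log^2N)$, $L=\Theta(\log^2N)$, and $\gamma=\sqrt{\frac{4e^{\epsilon/L}(1+e^{\epsilon/L})h_N}{(e^{\epsilon/L}-1)^2N}}$. Then, in both the fixed data setting and the i.i.d. data setting, Algorithm A (defined in the context) with privacy parameter $\epsilon$, depth $L$ and threshold $\gamma$ incurs an error $$\mathrm{Err}=O\left(\left(\frac{\ln^6N}{\epsilon^2N}\right)^{1/(2\alpha)}\right).$$
   Context: There are $N\ge 2$ users; user $i$ holds $x_i\in[-1,1]$, and $x_{(1)}\le\dots\le x_{(N)}$ are the ordered data. Data generation is described by a non-decreasing function $F:[-1,1]\to[0,1]$ (not depending on $N$), and $x_{\min}=\inf\{x\in[-1,1]:F(x)>0\}$. Fixed data setting: the data are deterministic, with $F(x_{(i)})=(i-1)/(N-1)$ for all $i=1,\dots,N$, and $x_{(1)}=x_{\min}$. I.i.d. data setting: $F$ is the cumulative distribution function of a distribution supported on $[-1,1]$ and $x_1,\dots,x_N$ are drawn i.i.d. from it. $\alpha$-fatness: for $\alpha>0$, $F$ is $\alpha$-fat if there exist constants $C>0$ and $\bar x\in[-1,1]$ with $\bar x>x_{\min}$ such that $F(x)\ge C(x-x_{\min})^\alpha$ for all $x_{\min}<x<\bar x$. Randomized response with privacy parameter $\eta>0$: on input $s\in\{-1,1\}$ it outputs $s$ with probability $e^\eta/(1+e^\eta)$ and $-s$ with probability $1/(1+e^\eta)$, using fresh independent randomness. Let $\mathrm{sign}(x)=1$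 if $x\ge0$ and $-1$ if $x<0$. Algorithm A (locally private minimum finding), with privacy parameter $\epsilon>0$, depth $L$ (a positive integer, which may depend on $N$), and threshold $\gamma$: set $\ell_1=-1$, $r_1=1$. For $t=1,\dots,L$: let $\tau_t=(\ell_t+r_t)/2$; each user $i$ reports $z'_i$, obtained by applying randomized response with privacy parameter $\epsilon/L$ to $\mathrm{sign}(\tau_t-x_i)$; the aggregator computes $\Phi'(z')=\frac1{2N}\frac{e^{\epsilon/L}+1}{e^{\epsilon/L}-1}\sum_{i=1}^Nz'_i+\frac12$; if $\Phi'(z')\ge\gamma$ set $(\ell_{t+1},r_{t+1})=(\ell_t,\tau_t)$, otherwise set $(\ell_{t+1},r_{t+1})=(\tau_t,r_t)$. Output $\tilde x=(\ell_{L+1}+r_{L+1})/2$. Error: $\mathrm{Err}=\mathbb E[|x_{\min}-\tilde x|]$, over the randomness of the algorithm and, in the i.i.d. setting, of the data. The asymptotics are as $N\to\infty$; $\epsilon$ may vary with $N$ but is bounded above, and the hidden constant may depend on $\alpha$, $C$, $\bar x$, the upper bound on $\epsilon$, and the constants in the two $\Theta(\log^2N)$ conditions.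
   Formalization: The hidden constant may also depend on x_min (fixed, since F does not depend on N); with only the listed parameters the bound fails in the i.i.d. setting when x̄ − x_min is arbitrarily small and ε²N is of order ln^6 N. *)

(* Defs.v *)
From HB Require Import structures.
From mathcomp Require Import all_boot all_order all_algebra.
From mathcomp Require Import all_classical all_reals all_analysis.
Import Order.TTheory GRing.Theory Num.Theory.
Import numFieldNormedType.Exports.

Set Implicit Arguments.
Unset Strict Implicit.
Unset Printing Implicit Defensive.

Local Open Scope classical_set_scope.
Local Open Scope ring_scope.

(* The function F : [-1, 1] -> [0, 1] is represented
   by a function on R of which only the restriction to [-1, 1] is ever used. *)
Definition data_function (R : realType) (F : R -> R) : Prop :=
  (forall x, -1 <= x <= 1 -> 0 <= F x <= 1) /\
  (forall x y, -1 <= x -> x <= y -> y <= 1 -> F x <= F y).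

Definition x_min (R : realType) (F : R -> R) : R :=
  inf [set x | -1 <= x <= 1 /\ 0 < F x].

(* alpha-fatness with explicit witnesses C and xbar. *)
Definition fat_with (R : realType) (F : R -> R) (alpha C xbar : R) : Prop :=
  [/\ 0 < alpha, 0 < C, -1 <= xbar <= 1, x_min F < xbar &
      forall x, x_min F < x -> x < xbar -> C * (x - x_min F) `^ alpha <= F x].

(* Order statistics, numbered from 0: x_(i) is order_stat x (i - 1). *)
Definition order_stat (R : realType) (N : nat) (x : 'I_N -> R) (i : nat) : R :=
  nth 0 (sort <=%R (codom x)) i.

Definition fixed_data (R : realType) (F : R -> R) (N : nat) (x : 'I_N -> R) :
    Prop :=
  [/\ forall i, -1 <= x i <= 1,
      forall i, (i < N)%N -> F (order_stat x i) = i%:R / (N%:R - 1) &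
      order_stat x 0 = x_min F].

Definition mutually_independent d (T : measurableType d) (R : realType)
    (P : probability T R) (I : finType) (Y : I -> {RV P >-> R}) : Prop :=
  forall (J : {set I}) (A : I -> set R), (forall i, measurable (A i)) ->
    P (\bigcap_(i in [set` J]) (Y i @^-1` A i)) =
    (\prod_(i | i \in J) P (Y i @^-1` A i))%E.

Definition has_cdf d (T : measurableType d) (R : realType)
    (P : probability T R) (F : R -> R) (X : {RV P >-> R}) : Prop :=
  P (X @^-1` `[-1, 1]) = 1%E /\
  (forall x, -1 <= x <= 1 -> cdf X x = (F x)%:E).

(* Randomized response on input s outputs z * s, where the fresh coin z
   equals 1 (keep) or -1 (flip) with the two probabilities below. *)
Definition rr_coin d (T : measurableType d) (R : realType)
    (P : probability T R) (eta : R) (Z : {RV P >-> R}) : Prop :=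
  P (Z @^-1` [set 1]) = (expR eta / (1 + expR eta))%:E /\
  P (Z @^-1` [set -1]) = (1 / (1 + expR eta))%:E.

Definition randomized_response (R : realType) (z s : R) : R := z * s.

(* Unlike Num.sg, this takes the value 1 at 0. *)
Definition sign (R : realType) (x : R) : R := if 0 <= x then 1 else -1.

Definition aggregate (R : realType) (N : nat) (eta : R) (z' : 'I_N -> R) : R :=
  1 / (2 * N%:R) * ((expR eta + 1) / (expR eta - 1)) * (\sum_(i < N) z' i)
  + 1 / 2.

Definition algA_step (R : realType) (N : nat) (eta gamma : R) (x : 'I_N -> R)
    (lr : R * R) (z : 'I_N -> R) : R * R :=
  let tau := (lr.1 + lr.2) / 2 in
  if gamma <= aggregate eta
       (fun i => randomized_response (z i) (sign (tau - x i)))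
  then (lr.1, tau) else (tau, lr.2).

(* The output of Algorithm A as a function of the data x and of the coins,
   z (t, i) being the one used by user i in round t. *)
Definition algA (R : realType) (N L : nat) (eps gamma : R) (x : 'I_N -> R)
    (z : 'I_L * 'I_N -> R) : R :=
  let lr := foldl (fun lr t => algA_step (eps / L%:R) gamma x lr
                                 (fun i => z (t, i)))
                  (-1, 1) (enum 'I_L) in
  (lr.1 + lr.2) / 2.

Definition Err d (T : measurableType d) (R : realType) (P : probability T R)
    (F : R -> R) (N L : nat) (eps gamma : R) (X : 'I_N -> T -> R)
    (Z : 'I_L * 'I_N -> T -> R) : \bar R :=
  ('E_P[fun w => `|x_min F - algA eps gamma (X ^~ w) (Z ^~ w)|%R])%E.

Definition threshold (R : realType) (N : nat) (eta h : R) : R :=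
  Num.sqrt (4 * expR eta * (1 + expR eta) * h
            / ((expR eta - 1) ^+ 2 * N%:R)).

(* f = Theta(log^2 N), with explicit constants. *)
Definition theta_ln2 (R : realType) (c1 c2 : R) (N1 : nat) (f : nat -> R) :
    Prop :=
  0 < c1 /\
  forall N, (N1 <= N)%N -> c1 * ln N%:R ^+ 2 <= f N <= c2 * ln N%:R ^+ 2.

Definition data_and_coins d (T : measurableType d) (R : realType)
    (P : probability T R) (I J : finType) (X : I -> {RV P >-> R})
    (Z : J -> {RV P >-> R}) (k : I + J) : {RV P >-> R} :=
  match k with inl i => X i | inr j => Z j end.

(* Main.v *)
Require Import Defs.
From mathcomp Require Import all_boot all_order all_algebra.
From mathcomp Require Import all_classical all_reals all_analysis.
From mathcomp Require Import measurable_realfun ring lra.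
Import Order.TTheory GRing.Theory Num.Theory.
Import numFieldNormedType.Exports.

(** Write gamma for the threshold and Phi(tau) for the share of users with data
    at most tau; in round t the aggregate of the reports is an unbiased estimate
    of Phi(tau_t), where tau_t is the midpoint at which the search stands.  The
    threshold is chosen so that h is, up to a factor, the Hoeffding exponent of a
    deviation gamma of that estimate.  Call a round misled if it turns left
    although Phi(tau_t) = 0, or right although Phi(tau_t) >= 2 gamma.

    A round is misled with probability at most exp(-h/4) ([misled_tail]), but
    tau_t is random and a union bound over the 2^t possible midpoints could lose
    against exp(-h/4), since L and h have the same order.  Instead the past of
    round t (the data and the coins of the other rounds) is split according to
    the finitely many vectors of answers sign(tau_t - x_i).  Each such vector is
    an event of the past, hence independent of the coins of round t, so that the
    uniform bound for a fixed vector survives the averaging over the past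
    ([tail_event], [round_misled_prob]).

    If no round is misled, the left end l of the final interval is -1 or has
    Phi(l) < 2 gamma, and its right end r is 1 or has a user at or below it.
    The latter gives r >= x_min.  For the former let delta = (4 gamma / C)^(1/alpha): fatness
    gives F(x_min + delta) >= 4 gamma, whence Phi(x_min + delta) >= 2 gamma, which
    bounds l by x_min + delta.  The bound Phi >= 2 gamma is deterministic for
    fixed data ([fixed_data_share]), where F <= 2 Phi, and one more Hoeffding
    bound at the deterministic point x_min + delta for i.i.d. data
    ([iid_sparse]).  So the error is O(delta) + 2^-L off an event of probability
    at most (L + 1) exp(-h/4), and it is at most 2 on that event
    ([expected_error]).

    Finally delta is of the claimed order because gamma^2 is of order
    h L^2 / (eps^2 N) ([threshold_le_rate]), whereas 2^-L and L exp(-h/4) are, up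
    to a constant factor, at most exp(-c ln^2 N) for some c > 0, which decays
    faster than any power of 1 / N ([gaussian_le_rate]). *)

Set Implicit Arguments.
Unset Strict Implicit.
Unset Printing Implicit Defensive.

Local Open Scope classical_set_scope.
Local Open Scope ring_scope.

(** * A Hoeffding bound for finite product weights *)

Lemma ler_sum_subpred (R : numDomainType) (I : finType) (P Q : pred I) (F : I -> R) :
  (forall i, 0 <= F i) -> (forall i, P i -> Q i) ->
  \sum_(i | P i) F i <= \sum_(i | Q i) F i.
Proof.
move=> F0 PQ; rewrite (bigID P Q) /= -[X in X <= _]addr0; apply: lerD.
  rewrite le_eqVlt (eq_bigl (fun i => Q i && P i)) ?eqxx // => i.
  by have [Pi|] := boolP (P i); rewrite ?andbF // PQ.
exact: sumr_ge0.
Qed.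

(** From 1 - x <= expR (- x), by inversion; a quadratic bound on expR with any
    constant is all that the Chernoff argument below needs. *)
Lemma expR_quad (R : realType) (x : R) :
  `|x| <= 1 / 2 -> expR x <= 1 + x + 2 * x ^+ 2.
Proof.
rewrite ler_norml => /andP[xl xr].
have x1 : 0 < 1 - x by lra.
have -> : expR x = (expR (- x))^-1 by rewrite expRN invrK.
have h : (expR (- x))^-1 <= (1 - x)^-1.
  rewrite lef_pV2 ?posrE ?expR_gt0 //; exact: expR_ge1Dx.
apply: (le_trans h).
rewrite -[X in X <= _]mul1r ler_pdivrMr //.
have -> : (1 + x + 2 * x ^+ 2) * (1 - x) = 1 + x ^+ 2 * (1 - 2 * x) by ring.
by rewrite lerDl mulr_ge0 ?sqr_ge0 //; lra.
Qed.

(** Hoeffding's inequality for independent centred variables v i with values in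
    a finite type, with p i the weights of the i-th variable: Chernoff's method
    applied to the product weights, whose moment generating function factorizes.
    The constant 8 is not optimal. *)
Lemma product_tail_bound (R : realType) (I V : finType) (p v : I -> V -> R)
    (b T : R) :
  (0 < #|I|)%N -> 0 < b -> 0 <= T ->
  (forall i z, 0 <= p i z) -> (forall i, \sum_z p i z = 1) ->
  (forall i z, `|v i z| <= b) -> (forall i, \sum_z p i z * v i z = 0) ->
  \sum_(f : {ffun I -> V} | T <= \sum_i v i (f i)) \prod_i p i (f i)
    <= expR (- (T ^+ 2 / (8 * #|I|%:R * b ^+ 2))).
Proof.
move=> I0 b0 T0 p0 p1 vb pv; set n : R := #|I|%:R.
have n0 : 0 < n by rewrite ltr0n.
(* A sum of n terms bounded by b cannot exceed n b; below that value the
   optimal l satisfies l b <= 1/2, as the quadratic bound requires. *)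
have [Tbig|Tsmall] := ltP (n * b) T.
  rewrite big_pred0 ?expR_ge0 // => f; apply/negbTE; rewrite -ltNge.
  apply: le_lt_trans Tbig.
  have -> : n * b = \sum_(i : I) b by rewrite sumr_const mulr_natl.
  by apply: ler_sum => i _; apply: le_trans (vb i (f i)); exact: ler_norm.
set l := T / (4 * n * b ^+ 2).
have b20 : 0 < b ^+ 2 by rewrite exprn_gt0.
have l0 : 0 <= l by rewrite divr_ge0 // !mulr_ge0 // ltW.
have lb : l * b <= 1 / 2.
  have -> : l * b = T / (4 * (n * b)) by rewrite /l; field; lra.
  have nb0 : 0 < n * b by rewrite mulr_gt0.
  by rewrite ler_pdivrMr ?mulr_gt0 //; lra.
have mgf i : \sum_z p i z * expR (l * v i z) <= expR (2 * (l * b) ^+ 2).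
  apply: (@le_trans _ _ (\sum_z p i z * (1 + l * v i z + 2 * (l * b) ^+ 2))).
    apply: ler_sum => z _; apply: ler_wpM2l => //.
    have lv : `|l * v i z| <= l * b by rewrite normrM ger0_norm // ler_wpM2l.
    apply: (le_trans (expR_quad _)); first exact: le_trans lb.
    rewrite lerD2l ler_pM2l // -[X in X <= _]real_normK ?num_real //.
    by rewrite lerXn2r // nnegrE mulr_ge0 // ltW.
  rewrite (eq_bigr (fun z => (1 + 2 * (l * b) ^+ 2) * p i z
                             + l * (p i z * v i z))); last first.
    by move=> z _; ring.
  rewrite big_split /= -!mulr_sumr p1 pv mulr0 addr0 mulr1.
  exact: expR_ge1Dx.
apply: (@le_trans _ _ (\sum_(f : {ffun I -> V})
    expR (- (l * T)) * \prod_i (p i (f i) * expR (l * v i (f i))))).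
  rewrite [X in _ <= X](bigID (fun f : {ffun I -> V} =>
    T <= \sum_i v i (f i))) /=.
  rewrite -[X in X <= _]addr0; apply: lerD; last first.
    apply: sumr_ge0 => f _; rewrite mulr_ge0 ?expR_ge0 //.
    by apply: prodr_ge0 => i _; rewrite mulr_ge0 ?expR_ge0.
  apply: ler_sum => f Tf; rewrite big_split /= mulrCA -[X in X <= _]mulr1.
  apply: ler_wpM2l; first exact: prodr_ge0.
  rewrite -expR_sum -expRD -expR0 ler_expR -mulr_sumr.
  by have := ler_wpM2l l0 Tf; lra.
rewrite -mulr_sumr -(bigA_distr_bigA (fun i z => p i z * expR (l * v i z))).
apply: (@le_trans _ _ (expR (- (l * T)) * \prod_(i : I) expR (2 * (l * b) ^+ 2))).
  apply: ler_wpM2l; first exact: expR_ge0.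
  apply: ler_prod => i _; rewrite mgf andbT.
  by apply: sumr_ge0 => z _; rewrite mulr_ge0 ?expR_ge0.
rewrite prodr_const -expRM_natl -expRD ler_expR -/n le_eqVlt; apply/orP; left.
apply/eqP; rewrite /l -mulr_natl -/n; field; rewrite ?lt0r_neq0 //.
Qed.

(** * Binary search steered by randomized answers *)

Section binary_search.
Context (R : realType) (N : nat).
Implicit Types (x z : 'I_N -> R) (s : {ffun 'I_N -> bool}).

Definition pm (b : bool) : R := if b then 1 else -1.

Definition below x (tau : R) : {ffun 'I_N -> bool} := [ffun i => x i <= tau].

Definition share s : R := (\sum_i (s i)%:R) / N%:R.

Definition report (eta : R) s z : R :=
  aggregate eta (fun i => randomized_response (z i) (pm (s i))).

(** The two wrong turns: left when nobody lies below the midpoint, right when at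
    least a share 2 gamma does.  For shares in between, either turn is fine. *)
Definition misled (eta gamma : R) s z : bool :=
  (share s == 0) && (gamma <= report eta s z) ||
  (2 * gamma <= share s) && (report eta s z < gamma).

Definition mid (lr : R * R) : R := (lr.1 + lr.2) / 2.

(** The interval after an arbitrary list r of rounds, so that the states of the
    algorithm before each round are those of the prefixes of the enumeration. *)
Definition search (L : nat) (eta gamma : R) x (z : 'I_L * 'I_N -> R)
    (r : seq 'I_L) : R * R :=
  foldl (fun lr t => algA_step eta gamma x lr (fun i => z (t, i))) (-1, 1) r.

Lemma algA_stepE eta gamma x lr z :
  algA_step eta gamma x lr z =
  if gamma <= report eta (below x (mid lr)) z then (lr.1, mid lr)
  else (mid lr, lr.2).
Proof.
rewrite /algA_step -/(mid lr) /report.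
suff -> : (fun i => randomized_response (z i) (sign (mid lr - x i))) =
  (fun i => randomized_response (z i) (pm (below x (mid lr) i))) by [].
by apply/funext => i; rewrite /sign /pm ffunE subr_ge0.
Qed.

Lemma search_rcons L eta gamma x (z : 'I_L * 'I_N -> R) r t :
  search eta gamma x z (rcons r t) =
  algA_step eta gamma x (search eta gamma x z r) (fun i => z (t, i)).
Proof. by rewrite /search -cats1 foldl_cat. Qed.

Lemma share_below_le x tau tau' :
  tau <= tau' -> share (below x tau) <= share (below x tau').
Proof.
move=> tt; rewrite /share ler_wpM2r ?invr_ge0 //; apply: ler_sum => i _.
rewrite !ffunE ler_nat; case: (leP (x i) tau) => // h.
by rewrite (le_trans h tt).
Qed.

Lemma share_below_neq0 x tau :
  share (below x tau) != 0 -> exists i, x i <= tau.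
Proof.
move=> f0; apply/existsP; apply: contra_neqT f0 => /existsPn h.
rewrite /share big1 ?mul0r // => i _.
by rewrite ffunE (negPf (h i)).
Qed.

(** An end of the interval that was moved is a former midpoint at which the turn
    was not a wrong one. *)
Lemma search_invariant L eta gamma x (z : 'I_L * 'I_N -> R) r : 0 < gamma ->
  (forall r1 t r2, r = r1 ++ t :: r2 ->
     ~~ misled eta gamma (below x (mid (search eta gamma x z r1)))
               (fun i => z (t, i))) ->
  let lr := search eta gamma x z r in
  [/\ lr.2 - lr.1 = 2 / 2 ^+ size r, -1 <= lr.1, lr.2 <= 1,
      lr.1 = -1 \/ share (below x lr.1) < 2 * gamma &
      lr.2 = 1 \/ share (below x lr.2) != 0].
Proof.
move=> g0; elim/last_ind: r => [_|r t IH good] /=.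
  by split; [rewrite /=; field|..|left|left].
have {IH} := IH _; case=> [r1 t' r2 rE|width lo hi Pl Pr].
  by apply: (good r1 t' (rcons r2 t)); rewrite rE rcons_cat.
have := good r t [::]; rewrite cats1 => /(_ erefl).
rewrite search_rcons algA_stepE.
set lr := search _ _ _ _ _ in width lo hi Pl Pr *.
set z' := fun i => z (t, i).
have w0 : 0 < 2 / 2 ^+ size r :> R by rewrite divr_gt0 // exprn_gt0.
have halve : 2 / 2 ^+ size (rcons r t) = (lr.2 - lr.1) / 2.
  by rewrite width size_rcons exprS; field; rewrite expf_neq0.
rewrite /misled negb_or !negb_and -!ltNge -leNgt halve.
case: leP => gr /andP[]; rewrite ?orbF /= => f0 f2; rewrite /mid in f0 f2 *.
  by split => //; [lra|lra|right].
by split => //; [lra|lra|right].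
Qed.

Lemma search_bounds L eta gamma x (z : 'I_L * 'I_N -> R) r :
  let lr := search eta gamma x z r in -1 <= lr.1 /\ lr.1 <= lr.2 <= 1.
Proof.
elim/last_ind: r => [|r t] /=; first by split => //; apply/andP; split => //=; lra.
rewrite search_rcons algA_stepE; move: (search _ _ _ _ _) => lr [lo /andP[lr12 hi]].
by case: ifP => _; rewrite /mid /=; split; try (apply/andP; split); lra.
Qed.

(** The left end cannot pass xm + delta, where the share is already 2 gamma, and
    the right end stays above xm.  When xm + delta is beyond xbar nothing is known
    there, but then delta >= xbar - xm and the factor 2 / (xbar - xm) makes the
    claim trivial, all points being in [-1, 1]. *)
Lemma algA_error L eta gamma x (z : 'I_L * 'I_N -> R) (xm xbar delta : R) :
  0 < gamma -> -1 <= xm <= 1 -> xm < xbar <= 1 -> 0 < delta ->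
  (forall i, xm <= x i) ->
  (xm + delta < xbar -> 2 * gamma <= share (below x (xm + delta))) ->
  (forall r1 t r2, enum 'I_L = r1 ++ t :: r2 ->
     ~~ misled eta gamma (below x (mid (search eta gamma x z r1)))
               (fun i => z (t, i))) ->
  `|xm - mid (search eta gamma x z (enum 'I_L))|
    <= (1 + 2 / (xbar - xm)) * delta + 1 / 2 ^+ L.
Proof.
move=> g0 /andP[xm1 xm2] /andP[xb1 xb2] d0 xmx dense good.
have [] := search_invariant g0 good; set lr := search _ _ _ _ _.
rewrite size_enum_ord => width lo hi Pl Pr.
have w0 : 0 < 1 / 2 ^+ L :> R by rewrite divr_gt0 // exprn_gt0.
have {}width : lr.2 - lr.1 = 2 * (1 / 2 ^+ L) by rewrite width; ring.
have c0 : 0 < 2 / (xbar - xm) by rewrite divr_gt0 // subr_gt0.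
have xr : xm <= lr.2.
  case: Pr => [->//|/share_below_neq0[i]]; exact: le_trans.
have cd0 : 0 < 2 / (xbar - xm) * delta by rewrite mulr_gt0.
have [c cE] : exists c, c = 2 / (xbar - xm) by exists (2 / (xbar - xm)).
have [w wE] : exists w : R, w = 1 / 2 ^+ L by exists (1 / 2 ^+ L).
rewrite -?cE -?wE in c0 w0 width cd0 *.
rewrite mulrDl mul1r ler_norml; apply/andP; split; last by rewrite /mid; lra.
have [big|small] := leP xbar (xm + delta).
  have : 2 <= c * delta.
    by rewrite cE mulrAC ler_pdivlMr ?subr_gt0 // ler_pM2l //; lra.
  by rewrite /mid; lra.
suff : lr.1 < xm + delta by rewrite /mid; lra.
rewrite ltNge; apply/negP => le; case: Pl => [l1|]; first by lra.
by apply/negP; rewrite -leNgt (le_trans (dense small)) // share_below_le.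
Qed.

Lemma measurable_search d (T : measurableType d) L eta gamma
    (X : 'I_N -> T -> R) (Z : 'I_L * 'I_N -> T -> R) (r : seq 'I_L) :
  (forall i, measurable_fun setT (X i)) ->
  (forall t i, t \in r -> measurable_fun setT (Z (t, i))) ->
  measurable_fun setT
    (fun w => (search eta gamma (X ^~ w) (Z ^~ w) r).1) /\
  measurable_fun setT
    (fun w => (search eta gamma (X ^~ w) (Z ^~ w) r).2).
Proof.
move=> mX; elim/last_ind: r => [_|r t IH mZ]; first by split; exact: measurable_cst.
have [|m1 m2] := IH; first by move=> t' i t'r; apply: mZ; rewrite mem_rcons inE t'r orbT.
have mmid : measurable_fun setT
    (fun w => mid (search eta gamma (X ^~ w) (Z ^~ w) r)).
  by apply: measurable_funM => //; exact: measurable_funD.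
have mtest : measurable_fun setT (fun w => gamma <=
    report eta (below (X ^~ w) (mid (search eta gamma (X ^~ w) (Z ^~ w) r)))
      (fun i => Z (t, i) w)).
  apply: measurable_fun_ler => //.
  apply: measurable_funD => //; apply: measurable_funM => //.
  apply: measurable_sum => i; apply: measurable_funM.
    by apply: mZ; rewrite mem_rcons inE eqxx.
  rewrite (_ : (fun w => _) = (fun w => if X i w <=
    mid (search eta gamma (X ^~ w) (Z ^~ w) r) then 1 else -1)); last first.
    by apply/funext => w; rewrite ffunE.
  by apply: measurable_fun_ifT => //; exact: measurable_fun_ler.
split.
  rewrite (_ : (fun w => _) = (fun w => if gamma <=
    report eta (below (X ^~ w) (mid (search eta gamma (X ^~ w) (Z ^~ w) r)))
      (fun i => Z (t, i) w) then (search eta gamma (X ^~ w) (Z ^~ w) r).1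
      else mid (search eta gamma (X ^~ w) (Z ^~ w) r))).
    exact: measurable_fun_ifT.
  by apply/funext => w; rewrite search_rcons algA_stepE; case: ifP.
rewrite (_ : (fun w => _) = (fun w => if gamma <=
    report eta (below (X ^~ w) (mid (search eta gamma (X ^~ w) (Z ^~ w) r)))
      (fun i => Z (t, i) w) then mid (search eta gamma (X ^~ w) (Z ^~ w) r)
      else (search eta gamma (X ^~ w) (Z ^~ w) r).2)).
  exact: measurable_fun_ifT.
by apply/funext => w; rewrite search_rcons algA_stepE; case: ifP.
Qed.

Lemma measurable_mid_search d (T : measurableType d) L eta gamma
    (X : 'I_N -> T -> R) (Z : 'I_L * 'I_N -> T -> R) (r : seq 'I_L) :
  (forall i, measurable_fun setT (X i)) ->
  (forall t i, t \in r -> measurable_fun setT (Z (t, i))) ->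
  measurable_fun setT
    (fun w => mid (search eta gamma (X ^~ w) (Z ^~ w) r)).
Proof.
move=> mX mZ; have [m1 m2] := measurable_search eta gamma mX mZ.
by apply: measurable_funM => //; exact: measurable_funD.
Qed.

Lemma measurable_below d (T : measurableType d) (X : 'I_N -> T -> R)
    (tau : T -> R) s :
  (forall i, measurable_fun setT (X i)) -> measurable_fun setT tau ->
  measurable [set w | below (X ^~ w) (tau w) = s].
Proof.
move=> mX mtau.
have -> : [set w | below (X ^~ w) (tau w) = s] =
    \bigcap_(i in [set: 'I_N]) (fun w => X i w <= tau w) @^-1` [set s i].
  apply/seteqP; split=> [w /= <- i _|w h]; first by rewrite /= ffunE.
  by apply/ffunP => i; rewrite ffunE; exact: h.
apply: fin_bigcap_measurable => [|i _]; first exact: finite_finset.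
rewrite -[X in measurable X]setTI.
by apply: measurable_fun_ler.
Qed.

End binary_search.

(** * Tail bounds for one round and for the data *)

Section finite_tails.
Context (R : realType) (N : nat).
Implicit Types (s f : {ffun 'I_N -> bool}) (eta gamma h : R).

Definition coin eta (b : bool) : R :=
  (if b then expR eta else 1) / (1 + expR eta).

(** The mean of a coin with values 1 and -1; its inverse is the factor by which
    the aggregate corrects the bias of the reports. *)
Definition coin_mean eta : R := (expR eta - 1) / (expR eta + 1).

Lemma threshold_sqr eta h : (0 < N)%N -> 0 < eta -> 0 < h ->
  N%:R * threshold N eta h ^+ 2 =
  4 * expR eta * (1 + expR eta) * h / (expR eta - 1) ^+ 2.
Proof.
move=> N0 eta0 h0; have e1 := expR_gt1 eta; rewrite eta0 in e1.
have n0 : 0 < N%:R :> R by rewrite ltr0n.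
rewrite /threshold sqr_sqrtr.
  by field; rewrite subr_eq0 !gt_eqF.
have ep := expR_ge0 eta; have ep1 : 0 <= 1 + expR eta by lra.
by rewrite !(divr_ge0, mulr_ge0) ?(ltW h0) // subr_ge0 ltW.
Qed.

Lemma threshold_gt0 eta h : (0 < N)%N -> 0 < eta -> 0 < h ->
  0 < threshold N eta h.
Proof.
move=> N0 eta0 h0; have e1 := expR_gt1 eta; rewrite eta0 in e1.
have n0 : 0 < N%:R :> R by rewrite ltr0n.
have ep := expR_gt0 eta; have ep1 : 0 < 1 + expR eta by lra.
by rewrite sqrtr_gt0 !(divr_gt0, mulr_gt0) // subr_gt0.
Qed.

(** The aggregate is an unbiased estimate of the share: its error is a weighted
    sum of the centred coins. *)
Lemma report_error eta s f : (0 < N)%N -> 0 < eta ->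
  report eta s (fun i => pm R (f i)) - share R s =
  (\sum_i pm R (s i) * (pm R (f i) - coin_mean eta))
    / (2 * N%:R * coin_mean eta).
Proof.
move=> N0 eta0; have e1 := expR_gt1 eta; rewrite eta0 in e1.
have n0 : 0 < N%:R :> R by rewrite ltr0n.
have pmE : \sum_i pm R (s i) = 2 * (\sum_i (s i)%:R) - N%:R.
  have -> : N%:R = \sum_(i < N) (1 : R) by rewrite sumr_const card_ord.
  rewrite mulr_sumr -sumrB; apply: eq_bigr => i _.
  by rewrite /pm; case: (s i); rewrite ?mulr0 ?mulr1; ring.
rewrite /report /aggregate /share.
have -> : \sum_i pm R (s i) * (pm R (f i) - coin_mean eta) =
    \sum_i randomized_response (pm R (f i)) (pm R (s i))
    - (2 * (\sum_i (s i)%:R) - N%:R) * coin_mean eta.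
  rewrite -pmE mulr_suml -sumrB; apply: eq_bigr => i _.
  by rewrite /randomized_response; ring.
rewrite /coin_mean.
by field; rewrite subr_eq0 !gt_eqF // ltr_pwDr // expR_gt0.
Qed.

(** With the answers s fixed, only one of the two wrong turns is possible, and it
    requires the estimate to be off by gamma in one direction. *)
Lemma misled_tail eta h s : (0 < N)%N -> 0 < eta -> 0 < h ->
  \sum_(f : {ffun 'I_N -> bool} |
          misled eta (threshold N eta h) s (fun i => pm R (f i)))
      \prod_i coin eta (f i) <= expR (- (h / 4)).
Proof.
move=> N0 eta0 h0; have e1 := expR_gt1 eta; rewrite eta0 in e1.
have n0 : 0 < N%:R :> R by rewrite ltr0n.
have g0 := threshold_gt0 N0 eta0 h0.
have g2 := threshold_sqr N0 eta0 h0.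
set g := threshold N eta h in g0 g2 *.
set m := coin_mean eta.
have m0 : 0 < m by rewrite divr_gt0 //; lra.
have m1 : m <= 1 by rewrite /m /coin_mean ler_pdivrMr; lra.
pose dir : R := if share R s == 0 then 1 else -1.
pose v (i : 'I_N) (b : bool) : R := dir * (pm R (s i) * (pm R b - m)).
have dirP : `|dir| = 1 by rewrite /dir; case: ifP; rewrite ?normrN normr1.
have pmP b : `|pm R b| = 1 by rewrite /pm; case: b; rewrite ?normrN normr1.
have c0 b : 0 <= coin eta b.
  by rewrite /coin divr_ge0 // ?addr_ge0 ?expR_ge0 //; case: b; rewrite ?expR_ge0.
have c1 : \sum_b coin eta b = 1.
  by rewrite big_bool /= /coin; field; lra.
have vb i b : `|v i b| <= 2.
  rewrite /v 2!normrM dirP pmP !mul1r.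
  by apply: (le_trans (ler_normB _ _)); rewrite pmP (ger0_norm (ltW m0)); lra.
have v0 i : \sum_b coin eta b * v i b = 0.
  rewrite big_bool /= /coin /v /= /m /coin_mean; field; lra.
(* An error gamma of the aggregate is a deviation 2 N gamma m of the sum of
   the centred coins, by report_error. *)
have cN : (0 < #|'I_N|)%N by rewrite card_ord.
have T0 : 0 <= 2 * N%:R * g * m.
  by rewrite mulr_ge0 ?(ltW m0) // mulr_ge0 ?(ltW g0) // mulr_ge0.
have := product_tail_bound cN (ltr0Sn R 1) T0 (fun=> c0) (fun=> c1) vb v0.
rewrite card_ord => tail.
apply: (@le_trans _ _ (expR (- ((2 * N%:R * g * m) ^+ 2 / (8 * N%:R * 2 ^+ 2))))).
  apply: le_trans tail.
  apply: ler_sum_subpred.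
    by move=> f; apply: prodr_ge0 => i _.
  move=> f; rewrite /misled /v -mulr_sumr => fm.
  have n2 : 0 < 2 * N%:R * m by rewrite mulr_gt0 // mulr_gt0.
  have := report_error s f N0 eta0; rewrite -/m.
  move=> /(congr1 ( *%R^~ (2 * N%:R * m))); rewrite divfK ?gt_eqF //= => <-.
  have -> : 2 * N%:R * g * m = g * (2 * N%:R * m) by ring.
  rewrite [X in _ <= X]mulrA ler_pM2r // /dir; move: fm.
  have [->|f0] /= := eqVneq (share R s) 0.
    by rewrite (lt_geF (mulr_gt0 (ltr0Sn R 1) g0)) /= orbF; lra.
  by move=> /andP[]; lra.
rewrite ler_expR lerN2.
have -> : (2 * N%:R * g * m) ^+ 2 / (8 * N%:R * 2 ^+ 2) = (N%:R * g ^+ 2) * m ^+ 2 / 8.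
  by field; lra.
rewrite g2 /m /coin_mean.
have -> : 4 * expR eta * (1 + expR eta) * h / (expR eta - 1) ^+ 2 *
  ((expR eta - 1) / (expR eta + 1)) ^+ 2 / 8 = h * expR eta / (2 * (1 + expR eta)).
  by field; rewrite subr_eq0 !gt_eqF //; lra.
rewrite ler_pdivlMr; last lra.
rewrite mulrAC ler_pdivrMr //.
have : h <= h * expR eta by rewrite ler_peMr // ltW.
lra.
Qed.

(** Hoeffding at half of the mean: the expected share q is at least 4 gamma. *)
Lemma sparse_tail eta h q : (0 < N)%N -> 0 < eta -> 0 < h ->
  4 * threshold N eta h <= q <= 1 ->
  \sum_(f : {ffun 'I_N -> bool} | share R f < 2 * threshold N eta h)
      \prod_i (if f i then q else 1 - q) <= expR (- (h / 4)).
Proof.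
move=> N0 eta0 h0 /andP[q0 q1]; have e1 := expR_gt1 eta; rewrite eta0 in e1.
have n0 : 0 < N%:R :> R by rewrite ltr0n.
have g0 := threshold_gt0 N0 eta0 h0.
have g2 := threshold_sqr N0 eta0 h0.
set g := threshold N eta h in q0 g0 g2 *.
pose v (i : 'I_N) (b : bool) : R := q - b%:R.
pose p (i : 'I_N) (b : bool) : R := if b then q else 1 - q.
have cN : (0 < #|'I_N|)%N by rewrite card_ord.
have T0 : 0 <= 2 * N%:R * g by rewrite mulr_ge0 ?(ltW g0) // mulr_ge0.
have p0 i b : 0 <= p i b by rewrite /p; case: b; lra.
have p1 i : \sum_b p i b = 1 by rewrite big_bool /= /p; ring.
have vb i b : `|v i b| <= 1.
  by rewrite /v ler_norml; case: b => /=; apply/andP; split; lra.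
have v0 i : \sum_b p i b * v i b = 0 by rewrite big_bool /= /p /v /=; ring.
have := product_tail_bound cN ltr01 T0 p0 p1 vb v0.
rewrite card_ord => tail.
apply: (@le_trans _ _ (expR (- ((2 * N%:R * g) ^+ 2 / (8 * N%:R * 1 ^+ 2))))).
  apply: le_trans tail.
  apply: ler_sum_subpred.
    by move=> f; apply: prodr_ge0 => i _; exact: p0.
  move=> f; rewrite /v /share ltr_pdivrMr // sumrB sumr_const card_ord -mulr_natl.
  have : N%:R * (4 * g) <= N%:R * q by rewrite ler_pM2l.
  lra.
rewrite ler_expR lerN2.
have -> : (2 * N%:R * g) ^+ 2 / (8 * N%:R * 1 ^+ 2) = (N%:R * g ^+ 2) / 2.
  by field; lra.
rewrite g2 ler_pdivlMr //.
rewrite ler_pdivlMr; last by rewrite exprn_gt0 // subr_gt0.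
have : h * (expR eta - 1) ^+ 2 <= h * (expR eta * (1 + expR eta)).
  by rewrite ler_pM2l //; nra.
have : 0 <= h * (expR eta * (1 + expR eta)) by rewrite !mulr_ge0; lra.
lra.
Qed.

End finite_tails.

(** * Independence from a sigma-algebra of the past *)

Section history.
Context d (T : measurableType d) (R : realType) (P : probability T R).
Context (K : finType) (Y : K -> {RV P >-> R}).

(** The events that prescribe the variables with index in S one by one; they form
    a pi-system generating the sigma-algebra of these variables. *)
Definition rectangles (S : {set K}) : set (set T) :=
  [set E | exists2 A : K -> set R, (forall k, measurable (A k)) &
     E = \bigcap_(k in [set` S]) (Y k @^-1` A k)].

Lemma measurable_rectangle (S : {set K}) (A : K -> set R) :
  (forall k, measurable (A k)) ->
  measurable (\bigcap_(k in [set` S]) (Y k @^-1` A k)).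
Proof.
move=> mA; apply: fin_bigcap_measurable => [|k _]; first exact: finite_finset.
by rewrite -[X in measurable X]setTI; exact: measurable_funPT.
Qed.

Lemma setI_closed_rectangles (S : {set K}) : setI_closed (rectangles S).
Proof.
move=> _ _ [A mA ->] [B mB ->]; exists (fun k => A k `&` B k).
  by move=> k; exact: measurableI.
by rewrite -bigcapI.
Qed.

Lemma sub_history_measurable (S : {set K}) :
  <<s rectangles S >> `<=` (measurable : set (set T)).
Proof.
apply: smallest_sub; first exact: sigma_algebra_measurable.
by move=> _ [A mA ->]; exact: measurable_rectangle.
Qed.

Lemma measurable_history (S : {set K}) (k : K) : k \in S ->
  measurable_fun [set: g_sigma_algebraType (rectangles S)]
    (Y k : g_sigma_algebraType (rectangles S) -> R).
Proof.
move=> kS _ B mB; rewrite setTI; apply: sub_sigma_algebra.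
exists (fun j => if j == k then B else setT).
  by move=> j; case: ifP.
apply/seteqP; split=> [w wB j /= jS|w wB]; last by have := wB k kS; rewrite /= eqxx.
by case: ifPn => // /eqP ->.
Qed.

(** Independence is assumed on rectangles only; as these are stable under
    intersection, uniqueness of measures extends it to the sigma-algebra that they
    generate. *)
Lemma history_independent (S J : {set K}) (H : set T) (B : K -> set R) :
  mutually_independent Y -> {in S, forall k, k \notin J} ->
  <<s rectangles S >> H -> (forall k, measurable (B k)) ->
  P (H `&` \bigcap_(k in [set` J]) (Y k @^-1` B k)) =
  (P H * \prod_(k in J) P (Y k @^-1` B k))%E.
Proof.
move=> indep SJ SH mB.
set D := \bigcap_(k in _) _.
have mD : measurable D by exact: measurable_rectangle.
have PD : P D = (\prod_(k in J) P (Y k @^-1` B k))%E by exact: indep.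
rewrite -PD muleC.
have PDfin : P D \is a fin_num by exact: fin_num_measure.
have c0 : 0 <= fine (P D) by exact: fine_ge0.
have -> : (P D * P H)%E = mscale (NngNum c0) P H by rewrite /mscale /= fineK.
rewrite -[LHS]/(mrestr P mD H).
have GE : [set X | rectangles S X /\ X `<=` setT] = rectangles S.
  by apply/seteqP; split=> [X []//|X SX]; split.
apply: (@g_sigma_algebra_measure_unique_trace _ _ _ (rectangles S) setT);
  rewrite ?GE //.
- by move=> _ [A mA ->]; exact: measurable_rectangle.
- exact: setI_closed_rectangles.
- rewrite -[LHS]/(P (setT `&` D)) -[RHS]/((fine (P D))%:E * P setT)%E.
  by rewrite setTI fineK // probability_setT mule1.
- move=> _ [A mA ->]; set E := \bigcap_(k in _) _.
  rewrite -[LHS]/(P (E `&` D)) -[RHS]/((fine (P D))%:E * P E)%E fineK // PD {}/E.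
  have -> : \bigcap_(k in [set` S]) (Y k @^-1` A k) `&` D =
      \bigcap_(k in [set` S :|: J]) (Y k @^-1` (if k \in S then A k else B k)).
    apply/seteqP; split=> [w [wA wB] k /=|w wC].
      rewrite inE => /orP[kS|kJ]; first by rewrite kS; exact: wA.
      by case: ifP => kS; [have := SJ k kS; rewrite kJ | exact: wB].
    split=> k /= kk; have := wC k; rewrite /= inE kk ?orbT.
      by move=> /(_ isT).
    by case: ifP => kS; [have := SJ k kS; rewrite kk | apply].
  rewrite indep; last by move=> k; case: ifP.
  rewrite (bigID (fun k => k \in S)) /= muleC; congr (_ * _)%E.
    apply: eq_big => [k|k /andP[_ /negPf ->]] //.
    rewrite inE; have [kS|kS] := boolP (k \in S); first by rewrite (negPf (SJ k kS)).
    by rewrite andbT.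
  rewrite indep //; apply: eq_big => [k|k /andP[_ ->]] //.
  by rewrite inE; case: (k \in S); rewrite //= andbF.
- rewrite -[X in (X < _)%E]/(P (setT `&` D)) setTI.
  by rewrite (le_lt_trans (probability_le1 _ mD)) ?ltry.
Qed.

End history.

(** * Events given by finitely many bits *)

Section finite_events.
Context d (T : measurableType d) (R : realType) (P : probability T R).

Lemma fsbig_setT (I : finType) (F : I -> \bar R) :
  (\sum_(i \in [set: I]) F i = \sum_i F i)%E.
Proof.
rewrite (@fsbigE _ _ _ _ _ (index_enum I)) ?index_enum_uniq //.
- by apply: eq_bigl => i; rewrite in_setT.
- by move=> i _; rewrite mem_index_enum.
Qed.

Lemma prob_EFin (A : set T) : measurable A -> P A = (fine (P A))%:E.
Proof. by move=> mA; rewrite fineK // fin_num_measure. Qed.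

Lemma prob_union (I : finType) (D : pred I) (F : I -> set T) (A : set T) :
  (forall i, measurable (F i)) -> measurable A ->
  (forall w, A w -> exists2 i, D i & F i w) ->
  fine (P A) <= \sum_(i | D i) fine (P (F i)).
Proof.
move=> mF mA AF; rewrite -lee_fin -prob_EFin // -sumEFin.
under eq_bigr do rewrite -prob_EFin //.
rewrite big_mkcond -(fsbig_setT (fun i => if D i then P (F i) else 0%E)).
have -> : (\sum_(i \in [set: I]) (if D i then P (F i) else 0) =
    \sum_(i \in [set: I]) P (if D i then F i else set0))%E.
  by apply: eq_fsbigr => i _; case: ifP => //; rewrite measure0.
apply: content_sub_fsum => //; first exact: finite_finset.
  by move=> i _; case: ifP.
by move=> w /AF[i Di Fi]; exists i => //; rewrite Di.
Qed.

Lemma prob_partition (V : finType) (s : T -> V) :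
  (forall v, measurable (s @^-1` [set v])) ->
  \sum_v fine (P (s @^-1` [set v])) = 1.
Proof.
move=> ms; apply: EFin_inj; rewrite -sumEFin.
under eq_bigr do rewrite -prob_EFin //.
rewrite -(fsbig_setT (fun v => P (s @^-1` [set v]))) -measure_fin_bigcup //; last 2 first.
- exact: finite_finset.
- by move=> u v _ _ [w [/= <- <-]].
rewrite -(@probability_setT _ _ _ P); congr (P _).
by apply/seteqP; split => // w _; exists (s w).
Qed.

Context (K : finType) (Y : K -> {RV P >-> R}).

Section cylinders.
Context (I : finType) (c : I -> K) (B : set R) (q : bool -> R) (S : {set K}).
Hypotheses (indep : mutually_independent Y) (injc : injective c).
Hypotheses (mB : measurable B) (Sc : forall i, c i \notin S).
Hypotheses (Pq : forall i, P (Y (c i) @^-1` B) = (q true)%:E).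
Hypothesis q1 : q false = 1 - q true.

(** All that a round or a data set reveals at a given point: one bit for each
    variable Y (c i). *)
Definition pattern (w : T) : {ffun I -> bool} := [ffun i => Y (c i) w \in B].

Lemma measurable_pattern f : measurable (pattern @^-1` [set f]).
Proof.
have -> : pattern @^-1` [set f] = \bigcap_(i in [set: I])
    (Y (c i) @^-1` (if f i then B else ~` B)).
  apply/seteqP; split=> [w /= <- i _|w h].
    rewrite ffunE /=; case: ifPn; first by rewrite inE.
    by move/negP => h hB; apply: h; rewrite inE.
  apply/ffunP => i; rewrite ffunE; have := h i Logic.I => /=.
  by case: (f i) => hB; [exact: mem_set | exact: memNset].
apply: fin_bigcap_measurable => [|i _]; first exact: finite_finset.
rewrite -[X in measurable X]setTI; apply: measurable_funPT => //.
by case: ifP => // _; exact: measurableC.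
Qed.

(** Given an event H of the past, the bits are still independent with weights
    q. *)
Lemma pattern_law (H : set T) (f : {ffun I -> bool}) :
  <<s rectangles Y S >> H ->
  fine (P (H `&` pattern @^-1` [set f])) = fine (P H) * \prod_i q (f i).
Proof.
move=> SH; have mH := sub_history_measurable SH.
pose B' (k : K) := if [pick i | c i == k] is Some i
  then (if f i then B else ~` B) else setT.
have B'c i : B' (c i) = if f i then B else ~` B.
  rewrite /B'; case: pickP => [j /eqP/injc -> //|/(_ i)].
  by rewrite eqxx.
have mB' k : measurable (B' k).
  by rewrite /B'; case: pickP => // i _; case: ifP => // _; exact: measurableC.
have SJ : {in S, forall k, k \notin c @: I}.
  move=> k kS; apply/negP => /imsetP[i _ kE].
  by have := Sc i; rewrite -kE kS.
have -> : pattern @^-1` [set f] =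
    \bigcap_(k in [set` c @: I]) (Y k @^-1` B' k).
  apply/seteqP; split=> [w /= wf _ /imsetP[i _ ->]|w h].
    rewrite /= B'c -wf ffunE; case: ifPn; first by rewrite inE.
    by move/negP => hn hB; apply: hn; rewrite inE.
  apply/ffunP => i; rewrite ffunE.
  have ck : c i \in c @: I by exact: imset_f.
  have := h (c i) ck; rewrite /= B'c.
  by case: (f i) => hB; [exact: mem_set | exact: memNset].
rewrite (history_independent indep SJ SH mB').
have -> : (\prod_(k in c @: I) P (Y k @^-1` B' k) = (\prod_i q (f i))%:E)%E.
  rewrite big_imset /=; last by move=> i j _ _ /injc.
  rewrite -prodEFin; apply: eq_bigr => i _; rewrite B'c.
  case: (f i); first exact: Pq.
  rewrite q1 EFinB -(Pq i) -probability_setC //.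
  by rewrite -[X in measurable X]setTI; exact: measurable_funPT.
by rewrite {1}(prob_EFin mH) -EFinM.
Qed.

(** The bound p, assumed for each fixed value v of a statistic s of the past,
    holds as well for s itself: sum over the values of s, whose probabilities add
    up to 1. *)
Lemma tail_event (V : finType) (s : T -> V) (D : V -> pred {ffun I -> bool})
    (p : R) :
  (forall v, <<s rectangles Y S >> (s @^-1` [set v])) ->
  (forall v, \sum_(f | D v f) \prod_i q (f i) <= p) ->
  measurable [set w | D (s w) (pattern w)] /\
  fine (P [set w | D (s w) (pattern w)]) <= p.
Proof.
move=> Ss tail.
have ms v : measurable (s @^-1` [set v]) by exact: (sub_history_measurable (Ss v)).
pose E (u : V * {ffun I -> bool}) := s @^-1` [set u.1] `&` pattern @^-1` [set u.2].
have mE u : measurable (E u) by apply: measurableI => //; exact: measurable_pattern.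
have mD : measurable [set w | D (s w) (pattern w)].
  have -> : [set w | D (s w) (pattern w)] = \bigcup_(u in [set u | D u.1 u.2]) E u.
    apply/seteqP; split=> [w Dw|w [[v f]] /= Dvf [/= -> ->]//].
    by exists (s w, pattern w).
  by apply: fin_bigcup_measurable => //; exact: finite_finset.
split => //.
have := @prob_union _ (fun u => D u.1 u.2) E _ mE mD.
move=> /(_ (fun w Dw => ex_intro2 _ _ (s w, pattern w) Dw (conj erefl erefl))).
move=> /le_trans; apply.
rewrite -(pair_big_dep predT (fun v f => D v f) (fun v f => fine (P (E (v, f))))) /=.
rewrite -[leRHS]mul1r -(prob_partition ms) mulr_suml.
apply: ler_sum => v _.
rewrite (eq_bigr (fun f : {ffun I -> bool} =>
  fine (P (s @^-1` [set v])) * \prod_i q (f i))); last first.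
  by move=> f _; exact: pattern_law.
by rewrite -mulr_sumr ler_wpM2l // fine_ge0.
Qed.

End cylinders.
End finite_events.

(** * Expected error of the search *)

Section expected_error.
Context d (T : measurableType d) (R : realType) (P : probability T R).

Lemma probU (A B : set T) : measurable A -> measurable B ->
  fine (P (A `|` B)) <= fine (P A) + fine (P B).
Proof.
move=> mA mB; rewrite -lee_fin EFinD -!prob_EFin //; first exact: measureU2.
exact: measurableU.
Qed.

Lemma expectation_le_off_event (f : T -> R) (A : set T) (a b : R) :
  measurable A -> measurable_fun setT f -> (forall w, 0 <= f w) ->
  0 <= a -> 0 <= b -> (forall w, f w <= b) -> (forall w, ~ A w -> f w <= a) ->
  ('E_P[f] <= (a + b * fine (P A))%:E)%E.
Proof.
move=> mA mf f0 a0 b0 fb fa; rewrite unlock.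
apply: (@le_trans _ _ (\int[P]_w (a%:E + b%:E * (\1_A w)%:E))%E).
  apply: ge0_le_integral => //.
  - by move=> w _; rewrite lee_fin.
  - exact/measurable_EFinP.
  - apply: emeasurable_funD => //; apply: emeasurable_funM => //.
    by apply/measurable_EFinP; exact: measurable_indic.
  - move=> w _; rewrite -EFinM -EFinD lee_fin indicE.
    have [wA|wA] := boolP (w \in A).
      by rewrite mulr1 (le_trans (fb w)) // lerDr.
    by rewrite mulr0 addr0 fa // => Aw; move/negP: wA; apply; rewrite inE.
have mind : measurable_fun setT (fun w => (\1_A w : R)%:E).
  by apply/measurable_EFinP; exact: measurable_indic.
have ind0 w : (0 <= (\1_A w : R)%:E)%E by rewrite lee_fin.
rewrite ge0_integralD //; last first.
- exact: emeasurable_funM.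
- by move=> w _; exact: mule_ge0.
rewrite ge0_integralZl //.
rewrite integral_indic // setIT -[X in (X + _)%E]/(\int[P]_w cst a%:E w)%E.
rewrite integral_cst // [X in (_ * X)%E](@probability_setT _ _ _ P) mule1.
by rewrite EFinD EFinM -prob_EFin.
Qed.

Context (K : finType) (Y : K -> {RV P >-> R}) (N L : nat).
Context (c : 'I_L * 'I_N -> K) (X : 'I_N -> T -> R) (eta h : R).
Hypotheses (indep : mutually_independent Y) (injc : injective c).
Hypotheses (N0 : (0 < N)%N) (eta0 : 0 < eta) (h0 : 0 < h).
Hypothesis coins : forall k, rr_coin eta (Y (c k)).

Let g := threshold N eta h.
Let Z (w : T) (k : 'I_L * 'I_N) : R := Y (c k) w.
Let state (w : T) (r : seq 'I_L) := mid (search eta g (X ^~ w) (Z w) r).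

Definition other_rounds (t : 'I_L) : {set K} := ~: ((fun i => c (t, i)) @: 'I_N).

Hypothesis mX : forall i, measurable_fun setT (X i).
(** The data may be constants or further variables of the family Y, as long as
    the coins of round t do not enter. *)
Hypothesis hX : forall t i,
  measurable_fun [set: g_sigma_algebraType (rectangles Y (other_rounds t))]
    (X i : g_sigma_algebraType (rectangles Y (other_rounds t)) -> R).

Definition round_misled (t : 'I_L) : set T := [set w |
  misled eta g (below (X ^~ w) (state w (take t (enum 'I_L))))
    (fun i => pm R (pattern Y (fun i => c (t, i)) [set 1] w i))].

(** The answers of the users in round t are determined by the data and by the
    coins of earlier rounds, so that the fixed-vector bound applies to them. *)
Lemma round_misled_prob t :
  measurable (round_misled t) /\ fine (P (round_misled t)) <= expR (- (h / 4)).
Proof.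
have inj : injective (fun i => c (t, i)) by move=> i j /injc [].
have St i : c (t, i) \notin other_rounds t.
  by rewrite inE negbK; exact: imset_f.
have m1 : measurable [set 1 : R] by [].
have Pq i : P (Y (c (t, i)) @^-1` [set 1]) = (coin eta true)%:E.
  by have [-> _] := coins (t, i).
have q1 : coin eta false = 1 - coin eta true.
  by rewrite /coin; field; rewrite gt_eqF // ltr_pwDl // expR_ge0.
have := @tail_event _ _ _ _ _ _ _ (fun i => c (t, i)) [set 1] (coin eta)
  (other_rounds t) indep inj m1 St Pq q1 _
  (fun w => below (X ^~ w) (state w (take t (enum 'I_L))))
  (fun s f => misled eta g s (fun i => pm R (f i))) (expR (- (h / 4))).
apply; last by move=> s; exact: misled_tail.
move=> s; pose T' := g_sigma_algebraType (rectangles Y (other_rounds t)).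
apply: (@measurable_below R N _ T' X) => //.
apply: (@measurable_mid_search R N _ T' L eta g X (fun k w => Z w k)) => //.
move=> t' i t't; apply: measurable_history; rewrite inE.
apply/negP => /imsetP[j _ /injc[t'E _]].
move: t't; rewrite t'E in_take ?mem_enum // index_enum_ord ltnn.
by [].
Qed.

(** The law of the coins only says that they are 1 or -1 almost surely. *)
Definition odd_coin (k : 'I_L * 'I_N) : set T :=
  ~` (Y (c k) @^-1` [set 1] `|` Y (c k) @^-1` [set -1]).

Lemma odd_coin_prob k : measurable (odd_coin k) /\ fine (P (odd_coin k)) = 0.
Proof.
have m1 (r : R) : measurable (Y (c k) @^-1` [set r]).
  by rewrite -[X in measurable X]setTI; exact: measurable_funPT.
have mU := measurableU _ _ (m1 1) (m1 (-1)).
split; first exact: measurableC.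
have PU : P (Y (c k) @^-1` [set 1] `|` Y (c k) @^-1` [set -1]) = 1%E.
  transitivity (P (Y (c k) @^-1` [set 1%R]) + P (Y (c k) @^-1` [set (-1)%R]))%E.
    apply: measureU => //; rewrite -subset0 => w /= [-> /eqP].
    by rewrite gt_eqF //; lra.
  have [-> ->] := coins k; rewrite -EFinD; congr EFin; field.
  by rewrite gt_eqF // ltr_pwDl // expR_ge0.
by rewrite probability_setC // [X in (_ - X)%E]PU subee.
Qed.

(** Off bad_data, off the misled rounds and off the odd coins, the deterministic
    bound applies; elsewhere the error is at most 2. *)
Lemma expected_error (xm xbar delta : R) (bad_data : set T) :
  -1 <= xm <= 1 -> xm < xbar <= 1 -> 0 < delta ->
  measurable bad_data -> fine (P bad_data) <= expR (- (h / 4)) ->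
  (forall w, ~ bad_data w -> (forall i, xm <= X i w) /\
     (xm + delta < xbar -> 2 * g <= share R (below (X ^~ w) (xm + delta)))) ->
  ('E_P[fun w => `|xm - state w (enum 'I_L)|%R] <=
    ((1 + 2 / (xbar - xm)) * delta + 1 / 2 ^+ L
      + 2 * ((L%:R + 1) * expR (- (h / 4))))%:E)%E.
Proof.
move=> xm1 xb1 d0 mb Pb good.
have /andP[xml xmr] := xm1; have /andP[xb _] := xb1.
pose mis := \bigcup_(t in [set: 'I_L]) round_misled t.
pose odd := \bigcup_(k in [set: 'I_L * 'I_N]) odd_coin k.
have mmis : measurable mis.
  apply: fin_bigcup_measurable => [|t _]; first exact: finite_finset.
  by have [] := round_misled_prob t.
have modd : measurable odd.
  apply: fin_bigcup_measurable => [|k _]; first exact: finite_finset.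
  by have [] := odd_coin_prob k.
have Pmis : fine (P mis) <= L%:R * expR (- (h / 4)).
  apply: (@le_trans _ _ (\sum_(t : 'I_L) fine (P (round_misled t)))).
    apply: prob_union => //; first by move=> t; have [] := round_misled_prob t.
    by move=> w [t _ tw]; exists t.
  rewrite mulr_natl -[in leRHS](card_ord L) -sumr_const.
  by apply: ler_sum => t _; have [] := round_misled_prob t.
have Podd : fine (P odd) <= 0.
  apply: (@le_trans _ _ (\sum_k fine (P (odd_coin k)))).
    apply: prob_union => //; first by move=> k; have [] := odd_coin_prob k.
    by move=> w [k _ kw]; exists k.
  by rewrite big1 // => k _; have [] := odd_coin_prob k.
have mbad : measurable (bad_data `|` (mis `|` odd)).
  by apply: measurableU => //; exact: measurableU.
have Pbad : fine (P (bad_data `|` (mis `|` odd))) <=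
    (L%:R + 1) * expR (- (h / 4)).
  apply: (le_trans (probU mb (measurableU _ _ mmis modd))).
  have := probU mmis modd; lra.
have g0 : 0 < g by exact: threshold_gt0.
apply: (@le_trans _ _ ((1 + 2 / (xbar - xm)) * delta + 1 / 2 ^+ L
    + 2 * fine (P (bad_data `|` (mis `|` odd))))%:E); last first.
  by rewrite lee_fin lerD2l ler_pM2l.
have p2 : 0 < 1 / 2 ^+ L :> R by rewrite divr_gt0 // exprn_gt0.
have p1 : 0 < 2 / (xbar - xm) by rewrite divr_gt0 // subr_gt0.
apply: expectation_le_off_event => //.
- apply: measurableT_comp => //; apply: measurable_funB => //.
  by apply: (@measurable_mid_search R N _ T L eta g X (fun k w => Z w k)).
- by rewrite addr_ge0 ?(ltW p2) // mulr_ge0 ?(ltW d0) // addr_ge0 // ltW.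
- move=> w; have [lo /andP[lr12 hi]] :=
    search_bounds eta g (X ^~ w) (Z w) (enum 'I_L).
  by rewrite /state /mid ler_norml; apply/andP; split; lra.
- move=> w /not_orP[nb /not_orP[nm no]].
  have [xmX dense] := good w nb.
  apply: algA_error => // r1 t r2 enumE; apply/negP => tw; apply: nm.
  have r1E : r1 = take t (enum 'I_L).
    have -> : nat_of_ord t = size r1.
      rewrite -(index_enum_ord t) enumE index_cat /= eqxx addn0.
      have : uniq (r1 ++ t :: r2) by rewrite -enumE enum_uniq.
      rewrite cat_uniq => /and3P[_ + _] /=; rewrite negb_or => /andP[tr1 _].
      by rewrite (negPf tr1).
    by rewrite enumE take_size_cat.
  exists t => //; rewrite /round_misled /= -r1E.
  suff -> : (fun i => pm R (pattern Y (fun i => c (t, i)) [set 1] w i)) =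
    (fun i => Z w (t, i)) by [].
  apply/funext => i; rewrite ffunE /Z.
  have [w1|w1] := boolP (Y (c (t, i)) w \in [set 1]).
    by move: w1; rewrite inE /= => ->.
  have : (Y (c (t, i)) @^-1` [set 1] `|` Y (c (t, i)) @^-1` [set -1]) w.
    by apply: contrapT => oddw; apply: no; exists (t, i).
  by case=> [w1'|->//]; move/negP: w1; case; exact: mem_set.
Qed.

End expected_error.

(** * Fixed and i.i.d. data *)

Section data_settings.
Context (R : realType).
Implicit Types (F : R -> R).

Lemma x_min_bounds F alpha C xbar : fat_with F alpha C xbar ->
  -1 <= x_min F <= 1 /\ x_min F < xbar <= 1.
Proof.
move=> [_ _ /andP[_ xb1] xb _]; rewrite xb xb1 (le_trans (ltW xb) xb1) andbT.
split => //; rewrite /x_min.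
have [->|/set0P ne] := eqVneq [set x | -1 <= x <= 1 /\ 0 < F x] set0.
  by rewrite inf0; lra.
by apply: lb_le_inf => // x [/andP[]].
Qed.

Lemma data_function_lt_x_min F x : data_function F ->
  -1 <= x <= 1 -> x < x_min F -> F x = 0.
Proof.
move=> [F01 _] x1 xlt; apply/eqP; rewrite eq_le.
have /andP[-> _] := F01 x x1; rewrite andbT leNgt.
apply/negP => Fx; move: xlt; rewrite ltNge => /negP; apply.
apply: ge_inf => //; exists (-1) => y [/andP[]] //.
Qed.

(** delta solves C delta^alpha = 4 g. *)
Lemma fat_level F alpha C xbar g : fat_with F alpha C xbar -> 0 < g ->
  let delta := (4 * g / C) `^ (1 / alpha) in
  x_min F + delta < xbar -> 4 * g <= F (x_min F + delta).
Proof.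
move=> [a0 C0 _ _ fat] g0 delta small.
have b0 : 0 < 4 * g / C by rewrite divr_gt0 // mulr_gt0.
have d0 : 0 < delta by exact: powR_gt0.
have := fat _ _ small; rewrite ltrDl => /(_ d0); apply: le_trans.
rewrite (addrC (x_min F)) addrK /delta -powRrM mul1r mulVf ?gt_eqF //.
by rewrite powRr1 ?(ltW b0) // [leRHS]mulrC divfK // gt_eqF.
Qed.

(** If k < N users lie below tau, the next order statistic exceeds tau and F takes
    the value k / (N - 1) <= 2 k / N there. *)
Lemma fixed_data_share F N (x : 'I_N -> R) tau : (2 <= N)%N ->
  data_function F -> fixed_data F x -> -1 <= tau <= 1 ->
  F tau <= 2 * share R (below x tau).
Proof.
move=> N2 [F01 Fmono] [x1 Fx _] tau1.
set s := sort <=%R (codom x).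
have s_sorted : sorted <=%R s by exact: sort_le_sorted.
have s_size : size s = N by rewrite size_sort size_codom card_ord.
have n0 : 0 < N%:R :> R by rewrite ltr0n; exact: leq_trans N2.
have n2 : 2 <= N%:R :> R by rewrite (ler_nat _ 2).
set k := count (fun y => y <= tau) s.
have shareE : share R (below x tau) = k%:R / N%:R.
  rewrite /share /k /s count_sort -sum1_count big_map [in RHS]big_enum_cond.
  congr (_ / _); rewrite natr_sum [RHS]big_mkcond /=; apply: eq_bigr => i _.
  by rewrite ffunE; case: ifP.
rewrite shareE; have [kN|Nk] := ltnP k N; last first.
  have kE : k = N by apply/eqP; rewrite eqn_leq Nk andbT -s_size; exact: count_size.
  have /andP[_ F1] := F01 tau tau1.
  by rewrite kE divff ?gt_eqF //; lra.
have ltk : tau < nth 0 s k by apply: nth_count_gt => //; rewrite s_size kN leqnn.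
have /codomP[i nthE] : nth 0 s k \in codom x.
  by rewrite -(mem_sort <=%R) mem_nth // s_size.
have : F tau <= F (nth 0 s k).
  have /andP[_ ?] := x1 i; have /andP[? _] := tau1.
  by apply: Fmono => //; [exact: ltW | rewrite nthE].
move=> /le_trans; apply; rewrite Fx // mulrA ler_pdivrMr; last lra.
rewrite mulrAC ler_pdivlMr // -subr_ge0.
have -> : 2 * k%:R * (N%:R - 1) - k%:R * N%:R = k%:R * (N%:R - 2) :> R by ring.
by rewrite mulr_ge0 // subr_ge0.
Qed.

Lemma fixed_data_ge F N (x : 'I_N -> R) i : fixed_data F x -> x_min F <= x i.
Proof.
move=> [_ _ <-]; rewrite /order_stat.
set s := sort <=%R (codom x).
have s_sorted : sorted <=%R s by exact: sort_le_sorted.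
have xs : x i \in s by rewrite mem_sort codom_f.
rewrite -[X in _ <= X](nth_index 0 xs).
apply: (sorted_leq_nth le_trans lexx) => //; rewrite inE ?index_mem //.
by case: s xs {s_sorted}.
Qed.

Section iid.
Context d (T : measurableType d) (P : probability T R).

(** The cdf vanishes at x_min - 1 / (n + 1) for every n: because F does, or because
    this point is below -1 and the law lives on [-1, 1]. *)
Lemma cdf_lt_x_min F (X : {RV P >-> R}) : data_function F -> -1 <= x_min F <= 1 ->
  has_cdf F X -> measurable [set w | X w < x_min F] /\ P [set w | X w < x_min F] = 0.
Proof.
move=> dF xm1 [X1 XF].
have mX (A : set R) : measurable A -> measurable (X @^-1` A).
  by move=> mA; rewrite -[X in measurable X]setTI; exact: measurable_funPT.
have mlt : measurable [set w | X w < x_min F].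
  have -> : [set w | X w < x_min F] = X @^-1` `]-oo, x_min F[.
    by apply/seteqP; split=> w /=; rewrite in_itv.
  exact: mX.
split => //; apply: measure_negligible => //.
apply: (@negligibleS _ _ _ _ (\bigcup_n (X @^-1` `]-oo, x_min F - n.+1%:R^-1]))).
  move=> w /= Xw; have [n nw] := ltr_add_invr Xw.
  by exists n => //=; rewrite in_itv /= lerBrDr ltW.
apply: negligible_bigcup => n; exists (X @^-1` `]-oo, x_min F - n.+1%:R^-1]).
split => //; first exact: mX.
set r := x_min F - n.+1%:R^-1.
have rlt : r < x_min F by rewrite ltrBlDr ltrDl invr_gt0.
have [r1|r1] := leP (-1) r.
  have r11 : -1 <= r <= 1.
    by rewrite r1 /=; have /andP[_] := xm1; move/(lt_le_trans rlt)/ltW.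
  by rewrite -[LHS]/(cdf X r) XF // data_function_lt_x_min.
apply/eqP; rewrite -measure_le0 -[X in (_ <= X)%E](@subee _ 1%E) //.
rewrite -[X in (_ <= _ - X)%E]X1 -probability_setC; last exact: mX.
apply: le_measure; rewrite ?inE; [exact: mX|exact/measurableC/mX|].
by move=> w /=; rewrite !in_itv /= => Xr /andP[Xl _]; lra.
Qed.

(** The point theta being deterministic, no uniform control of the empirical
    distribution function is needed; the past is trivial here. *)
Lemma iid_sparse F (J : finType) N (X : 'I_N -> {RV P >-> R})
    (Z : J -> {RV P >-> R}) (eta h theta : R) :
  (0 < N)%N -> 0 < eta -> 0 < h ->
  (forall i, has_cdf F (X i)) -> mutually_independent (data_and_coins X Z) ->
  -1 <= theta <= 1 -> 4 * threshold N eta h <= F theta <= 1 ->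
  let E := [set w | share R (below (fun i => X i w) theta)
                    < 2 * threshold N eta h] in
  measurable E /\ fine (P E) <= expR (- (h / 4)).
Proof.
move=> N0 eta0 h0 XF indep th1 Fth E.
have inj : injective (@inl 'I_N J) by move=> i j [].
have mB : measurable (`]-oo, theta] : set R) by [].
have S0 (i : 'I_N) : inl i \notin (finset.set0 : {set 'I_N + J}) by rewrite inE.
have Pq i : P (data_and_coins X Z (inl i) @^-1` `]-oo, theta]) =
    (if true then F theta else 1 - F theta)%:E.
  by have [_ /(_ theta th1) <-] := XF i.
have := @tail_event _ _ _ _ _ _ _ inl (`]-oo, theta] : set R)
  (fun b => if b then F theta else 1 - F theta) finset.set0 indep inj mB S0 Pq
  erefl unit (fun=> tt) (fun _ f => share R f < 2 * threshold N eta h)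
  (expR (- (h / 4))).
have -> : [set w | share R (pattern (data_and_coins X Z) inl `]-oo, theta] w)
    < 2 * threshold N eta h] = E.
  apply/seteqP; split => w; rewrite /E /=;
  suff -> : pattern (data_and_coins X Z) inl `]-oo, theta] w =
    below (fun i => X i w) theta by []; apply/ffunP => i; rewrite !ffunE /=;
  by apply/idP/idP; rewrite inE /= in_itv.
apply; last by move=> _; exact: sparse_tail.
move=> []; have -> : (fun _ : T => tt) @^-1` [set tt] = setT.
  by apply/seteqP; split.
exact: (@measurableT _ (g_sigma_algebraType
  (rectangles (data_and_coins X Z) finset.set0))).
Qed.

End iid.
End data_settings.

(** * Rates *)

Section rates.
Context (R : realType).
Implicit Types (alpha M c u eps : R).

(** Bounds the ratio of exp(-c ln^2 N) to the rate, uniformly in N and eps. *)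
Definition decay_constant alpha M c : R :=
  expR (1 / (16 * alpha ^+ 2 * c)) / (ln 2 ^+ 6 / M ^+ 2) `^ (1 / (2 * alpha)).

(** With u = ln N, the rate is at least a constant times exp(-u / (2 alpha)), and
    u / (2 alpha) - c u^2 is maximal at u = 1 / (4 alpha c), where it equals
    1 / (16 alpha^2 c). *)
Lemma gaussian_le_rate alpha M c eps (N : nat) : (2 <= N)%N -> 0 < alpha ->
  0 < c -> 0 < eps <= M ->
  expR (- (c * ln N%:R ^+ 2)) <= decay_constant alpha M c *
    (ln N%:R ^+ 6 / (eps ^+ 2 * N%:R)) `^ (1 / (2 * alpha)).
Proof.
move=> N2 a0 c0 /andP[e0 eM].
have n0 : 0 < N%:R :> R by rewrite ltr0n; exact: leq_trans N2.
have ln20 : 0 < ln 2 :> R by rewrite ln_gt0 // ltr1n.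
have lnN : ln 2 <= ln N%:R :> R by rewrite ler_ln ?posrE // (ler_nat _ 2).
have M0 : 0 < M by exact: lt_le_trans eM.
set u := ln N%:R in lnN *.
have Nu : N%:R = expR u :> R by rewrite lnK ?posrE.
have v0 : 0 < ln 2 ^+ 6 / M ^+ 2 :> R by rewrite divr_gt0 ?exprn_gt0.
have p0 : 0 <= 1 / (2 * alpha) by rewrite divr_ge0 // mulr_ge0 // ltW.
have step : (ln 2 ^+ 6 / M ^+ 2) `^ (1 / (2 * alpha)) * expR (- (u / (2 * alpha)))
   <= (u ^+ 6 / (eps ^+ 2 * N%:R)) `^ (1 / (2 * alpha)).
  have -> : - (u / (2 * alpha)) = - u * (1 / (2 * alpha)) by ring.
  rewrite expRM -powRM ?expR_ge0 ?(ltW v0) //.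
  apply: ge0_ler_powR => //; rewrite ?nnegrE.
  - by rewrite mulr_ge0 ?expR_ge0 // ltW.
  - apply: divr_ge0; first by rewrite exprn_ge0 // (le_trans (ltW ln20)).
    by apply: mulr_ge0; rewrite ?sqr_ge0 ?(ltW n0).
  rewrite expRN -Nu.
  have -> : u ^+ 6 / (eps ^+ 2 * N%:R) = u ^+ 6 / eps ^+ 2 * N%:R^-1.
    by rewrite invfM -mulrA.
  rewrite ler_pM2r ?invr_gt0 //.
  apply: ler_pM => //; rewrite ?invr_ge0 ?sqr_ge0 ?exprn_ge0 ?(ltW ln20) //.
    by rewrite lerXn2r // nnegrE ltW // (lt_le_trans ln20).
  rewrite lef_pV2 ?posrE ?exprn_gt0 //.
  by rewrite lerXn2r // nnegrE ltW.
set w := (ln 2 ^+ 6 / M ^+ 2) `^ _ in step *.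
have w0 : 0 < w by exact: powR_gt0.
rewrite /decay_constant -/w.
apply: (@le_trans _ _ (expR (1 / (16 * alpha ^+ 2 * c)) / w *
  (w * expR (- (u / (2 * alpha)))))); last first.
  by rewrite ler_pM2l // divr_gt0 // expR_gt0.
rewrite mulrA divfK ?gt_eqF // -expRD ler_expR -subr_ge0.
have -> : 1 / (16 * alpha ^+ 2 * c) - u / (2 * alpha) - - (c * u ^+ 2) =
  c * (u - 1 / (4 * alpha * c)) ^+ 2.
  by field; rewrite !gt_eqF.
by rewrite mulr_ge0 ?sqr_ge0 // ltW.
Qed.

Definition threshold_constant M (CL Ch : R) : R :=
  Num.sqrt (4 * expR M * (1 + expR M) * Ch * CL ^+ 2).

(** With eta = eps / L, exp(eta) - 1 >= eta = eps / L turns the denominator of the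
    threshold into eps^2 N / L^2, and eta <= M bounds the numerator. *)
Lemma threshold_le_rate M CL Ch eps h (N L : nat) :
  (2 <= N)%N -> (0 < L)%N -> 0 < eps <= M -> 0 < h ->
  L%:R <= CL * ln N%:R ^+ 2 -> h <= Ch * ln N%:R ^+ 2 ->
  threshold N (eps / L%:R) h <= threshold_constant M CL Ch *
    (ln N%:R ^+ 6 / (eps ^+ 2 * N%:R)) `^ (1 / 2).
Proof.
move=> N2 L0 /andP[e0 eM] h0 LC hC.
have n0 : 0 < N%:R :> R by rewrite ltr0n; exact: leq_trans N2.
have l0 : 0 < L%:R :> R by rewrite ltr0n.
have l1 : 1 <= L%:R :> R by rewrite ler1n.
have u0 : 0 < ln N%:R :> R by rewrite ln_gt0 // ltr1n.
set u := ln N%:R in u0 LC hC *.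
have u20 : 0 < u ^+ 2 by rewrite exprn_gt0.
have CL0 : 0 < CL by have := lt_le_trans l0 LC; rewrite pmulr_lgt0.
have Ch0 : 0 < Ch by have := lt_le_trans h0 hC; rewrite pmulr_lgt0.
set eta := eps / L%:R.
have eta0 : 0 < eta by rewrite divr_gt0.
have etaM : eta <= M.
  by apply: le_trans eM; rewrite /eta ler_pdivrMr // ler_peMr // ltW.
have eeM : expR eta <= expR M by rewrite ler_expR.
have e1 := expR_ge1Dx eta.
have B0 : 0 <= u ^+ 6 / (eps ^+ 2 * N%:R).
  apply: divr_ge0; first by rewrite exprn_ge0 // ltW.
  by apply: mulr_ge0; rewrite ?sqr_ge0 ?(ltW n0).
have eM0 : 0 <= 4 * expR M * (1 + expR M).
  by rewrite !mulr_ge0 ?addr_ge0 ?expR_ge0.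
have ee0 : 0 <= 4 * expR eta * (1 + expR eta).
  by rewrite !mulr_ge0 ?addr_ge0 ?expR_ge0.
have K0 : 0 <= 4 * expR M * (1 + expR M) * Ch * CL ^+ 2.
  by rewrite mulr_ge0 ?sqr_ge0 // mulr_ge0 // ltW.
rewrite mul1r powR12_sqrt // -sqrtrM //.
rewrite ler_sqrt; last exact: mulr_ge0.
apply: (@le_trans _ _ (4 * expR M * (1 + expR M) * (Ch * u ^+ 2)
    / (eta ^+ 2 * N%:R))).
  apply: ler_pM.
  - by rewrite mulr_ge0 // ltW.
  - by rewrite invr_ge0 mulr_ge0 ?sqr_ge0 // ltW.
  - apply: ler_pM => //; rewrite ?(ltW h0) //.
    apply: ler_pM => //; rewrite ?mulr_ge0 ?addr_ge0 ?expR_ge0 ?lerD2l //.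
    by rewrite ler_pM2l.
  - have ee1 : 0 < expR eta - 1 by lra.
    have sq0 : 0 < (expR eta - 1) ^+ 2 by rewrite exprn_gt0.
    have et0 : 0 < eta ^+ 2 by rewrite exprn_gt0.
    rewrite lef_pV2 ?posrE; [|exact: mulr_gt0|exact: mulr_gt0].
    by rewrite ler_pM2r // lerXn2r // ?nnegrE; lra.
have -> : 4 * expR M * (1 + expR M) * (Ch * u ^+ 2) / (eta ^+ 2 * N%:R) =
    4 * expR M * (1 + expR M) * Ch * u ^+ 2 / (eps ^+ 2 * N%:R) * L%:R ^+ 2.
  by rewrite /eta; field; rewrite !gt_eqF.
have -> : 4 * expR M * (1 + expR M) * Ch * CL ^+ 2 * (u ^+ 6 / (eps ^+ 2 * N%:R)) =
    4 * expR M * (1 + expR M) * Ch * u ^+ 2 / (eps ^+ 2 * N%:R) * (CL * u ^+ 2) ^+ 2.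
  by field; rewrite !gt_eqF.
apply: ler_wpM2l.
  apply: divr_ge0; last by rewrite mulr_ge0 ?sqr_ge0 // ltW.
  by rewrite mulr_ge0 ?sqr_ge0 // mulr_ge0 // ltW.
by rewrite lerXn2r // nnegrE ltW // (lt_le_trans l0).
Qed.

Lemma level_le_rate alpha C M CL Ch eps h (N L : nat) :
  0 < alpha -> 0 < C -> (2 <= N)%N -> (0 < L)%N -> 0 < eps <= M -> 0 < h ->
  L%:R <= CL * ln N%:R ^+ 2 -> h <= Ch * ln N%:R ^+ 2 ->
  (4 * threshold N (eps / L%:R) h / C) `^ (1 / alpha) <=
    (4 * threshold_constant M CL Ch / C) `^ (1 / alpha) *
    (ln N%:R ^+ 6 / (eps ^+ 2 * N%:R)) `^ (1 / (2 * alpha)).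
Proof.
move=> a0 C0 N2 L0 eM h0 LC hC.
have := threshold_le_rate N2 L0 eM h0 LC hC.
set B := ln _ ^+ 6 / _ => le.
have -> : B `^ (1 / (2 * alpha)) = (B `^ (1 / 2)) `^ (1 / alpha).
  by rewrite -powRrM; congr (_ `^ _); field; rewrite gt_eqF.
move: le; set b := B `^ (1 / 2) => le.
have b0 : 0 <= b by exact: powR_ge0.
have c0 : 0 <= threshold_constant M CL Ch by exact: sqrtr_ge0.
have t0 : 0 <= threshold N (eps / L%:R) h by exact: sqrtr_ge0.
have Ci : 0 <= C^-1 by rewrite invr_ge0 ltW.
rewrite -powRM // ?mulr_ge0 //.
apply: ge0_ler_powR; first by rewrite divr_ge0 // ltW.
- by rewrite nnegrE divr_ge0 ?(ltW C0) // mulr_ge0.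
- by rewrite nnegrE mulr_ge0 // divr_ge0 ?(ltW C0) // mulr_ge0.
by rewrite [leRHS]mulrAC ler_wpM2r // -mulrA ler_wpM2l.
Qed.

Lemma depth_le_rate alpha M cL eps (N L : nat) : 0 < alpha -> 0 < cL ->
  (2 <= N)%N -> 0 < eps <= M -> cL * ln N%:R ^+ 2 <= L%:R ->
  1 / 2 ^+ L <= decay_constant alpha M (ln 2 * cL) *
    (ln N%:R ^+ 6 / (eps ^+ 2 * N%:R)) `^ (1 / (2 * alpha)).
Proof.
move=> a0 cL0 N2 eM LC.
have ln20 : 0 < ln 2 :> R by rewrite ln_gt0 // ltr1n.
apply: le_trans (gaussian_le_rate N2 a0 (mulr_gt0 ln20 cL0) eM).
have -> : 2 ^+ L = expR (L%:R * ln 2) :> R by rewrite expRM_natl lnK ?posrE.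
by rewrite div1r -expRN ler_expR lerN2 -mulrA mulrC ler_pM2r.
Qed.

(** Half of the exponent ch ln^2 N / 4 absorbs the factor L = O(ln^2 N), through
    y <= expR y; the other half decays. *)
Lemma failure_le_rate alpha M CL ch eps h (N L : nat) :
  0 < alpha -> 0 < ch -> (2 <= N)%N -> (0 < L)%N -> 0 < eps <= M ->
  L%:R <= CL * ln N%:R ^+ 2 -> ch * ln N%:R ^+ 2 <= h ->
  2 * ((L%:R + 1) * expR (- (h / 4))) <=
    32 * CL / ch * decay_constant alpha M (ch / 8) *
    (ln N%:R ^+ 6 / (eps ^+ 2 * N%:R)) `^ (1 / (2 * alpha)).
Proof.
move=> a0 ch0 N2 L0 eM LC hC.
have ch80 : 0 < ch / 8 by rewrite divr_gt0.
have l1 : 1 <= L%:R :> R by rewrite ler1n.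
have u0 : 0 < ln N%:R :> R by rewrite ln_gt0 // ltr1n.
have := gaussian_le_rate N2 a0 ch80 eM.
set u := ln N%:R in u0 LC hC *; set B := _ `^ _ => rate.
have u20 : 0 < u ^+ 2 by rewrite exprn_gt0.
have CL0 : 0 < CL by have := lt_le_trans ltr01 (le_trans l1 LC); rewrite pmulr_lgt0.
apply: (@le_trans _ _ (32 * CL / ch * expR (- (ch / 8 * u ^+ 2)))); last first.
  by rewrite -[leRHS]mulrA ler_pM2l // divr_gt0 // mulr_gt0.
apply: (@le_trans _ _ (4 * CL * u ^+ 2 * expR (- (ch * u ^+ 2 / 4)))).
  rewrite mulrA; apply: ler_pM; rewrite ?expR_ge0 ?mulr_ge0 ?addr_ge0 //.
    by rewrite -mulrA; lra.
  by rewrite ler_expR lerN2 ler_pM2r ?invr_gt0.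
have -> : - (ch * u ^+ 2 / 4) = - (ch / 8 * u ^+ 2) + - (ch / 8 * u ^+ 2).
  by field.
rewrite expRD mulrA ler_pM2r ?expR_gt0 //.
have := expR_ge1Dx (ch / 8 * u ^+ 2).
rewrite expRN ler_pdivrMr ?expR_gt0 // => ex.
have -> : 4 * CL * u ^+ 2 = 32 * CL / ch * (ch / 8 * u ^+ 2).
  by field; rewrite gt_eqF.
rewrite ler_pM2l; last by rewrite divr_gt0 // mulr_gt0.
lra.
Qed.

End rates.

Definition error_constant (R : realType)
    (alpha C xbar xmin M cL CL ch Ch : R) : R :=
  (1 + 2 / (xbar - xmin)) * (4 * threshold_constant M CL Ch / C) `^ (1 / alpha)
  + decay_constant alpha M (ln 2 * cL)
  + 32 * CL / ch * decay_constant alpha M (ch / 8).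

Lemma error_le_rate (R : realType)
    (alpha C xbar xmin M cL CL ch Ch eps h : R) (N L : nat) :
  0 < alpha -> 0 < C -> xmin < xbar -> 0 < cL -> 0 < ch ->
  (2 <= N)%N -> (0 < L)%N -> 0 < eps <= M ->
  cL * ln N%:R ^+ 2 <= L%:R <= CL * ln N%:R ^+ 2 ->
  ch * ln N%:R ^+ 2 <= h <= Ch * ln N%:R ^+ 2 ->
  (1 + 2 / (xbar - xmin)) * (4 * threshold N (eps / L%:R) h / C) `^ (1 / alpha)
    + 1 / 2 ^+ L + 2 * ((L%:R + 1) * expR (- (h / 4)))
  <= error_constant alpha C xbar xmin M cL CL ch Ch *
     (ln N%:R ^+ 6 / (eps ^+ 2 * N%:R)) `^ (1 / (2 * alpha)).
Proof.
move=> a0 C0 xb cL0 ch0 N2 L0 eM /andP[cLL LCL] /andP[chh hCh].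
have u0 : 0 < ln N%:R :> R by rewrite ln_gt0 // ltr1n.
have h0 : 0 < h by apply: lt_le_trans chh; rewrite mulr_gt0 // exprn_gt0.
rewrite /error_constant [leRHS]mulrDl.
apply: lerD; last exact: failure_le_rate.
rewrite [leRHS]mulrDl; apply: lerD; last exact: depth_le_rate.
rewrite -[leRHS]mulrA ler_wpM2l //; last exact: level_le_rate.
by rewrite addr_ge0 // divr_ge0 // subr_ge0 ltW.
Qed.

Unset Implicit Arguments.

Theorem corollary2 (R : realType)
    (alpha C xbar xmin M cL CL ch Ch : R) (N1 : nat) :
  exists (K : R) (N0 : nat),
  forall (F : R -> R) (eps h : nat -> R) (L : nat -> nat),
    data_function F ->
    x_min F = xmin ->
    fat_with F alpha C xbar ->
    (forall N, 0 < eps N <= M) ->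
    theta_ln2 ch Ch N1 h ->
    (forall N, (0 < L N)%N) ->
    theta_ln2 cL CL N1 (fun N => (L N)%:R) ->
  forall N : nat, (2 <= N)%N -> (N0 <= N)%N ->
  let eta := eps N / (L N)%:R in
  let gamma := threshold N eta (h N) in
  let bound := K * (ln N%:R ^+ 6 / (eps N ^+ 2 * N%:R)) `^ (1 / (2 * alpha)) in
  (* fixed data setting *)
  (forall (d : measure_display) (T : measurableType d) (P : probability T R)
      (x : 'I_N -> R) (Z : 'I_(L N) * 'I_N -> {RV P >-> R}),
    fixed_data F x ->
    (forall k, rr_coin eta (Z k)) ->
    mutually_independent Z ->
    (Err P F (eps N) gamma (fun i (_ : T) => x i) (fun k => Z k : T -> R)
       <= bound%:E)%E) /\
  (* i.i.d. data setting *)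
  (forall (d : measure_display) (T : measurableType d) (P : probability T R)
      (X : 'I_N -> {RV P >-> R}) (Z : 'I_(L N) * 'I_N -> {RV P >-> R}),
    (forall i, has_cdf F (X i)) ->
    (forall k, rr_coin eta (Z k)) ->
    mutually_independent (data_and_coins X Z) ->
    (Err P F (eps N) gamma (fun i => X i : T -> R) (fun k => Z k : T -> R)
       <= bound%:E)%E).
Proof.
exists (error_constant alpha C xbar xmin M cL CL ch Ch), N1.
move=> F eps h L dF <- fatF epsM [ch0 hN] L0 [cL0 LN] N N2 N1N eta gamma bound.
have Npos : (0 < N)%N by exact: leq_trans N2.
have [xm1 xb1] := x_min_bounds fatF.
have [alpha0 C0 _ xb _] := fatF.
have rate := error_le_rate alpha0 C0 xb cL0 ch0 N2 (L0 N) (epsM N) (LN N N1N)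
  (hN N N1N).
have eta0 : 0 < eta by have /andP[e0 _] := epsM N; rewrite divr_gt0 // ltr0n.
have h0 : 0 < h N.
  have /andP[+ _] := hN N N1N; apply: lt_le_trans.
  by rewrite mulr_gt0 // exprn_gt0 // ln_gt0 // ltr1n.
have g0 : 0 < gamma by exact: threshold_gt0.
set delta := (4 * gamma / C) `^ (1 / alpha) in rate.
have d0 : 0 < delta by rewrite powR_gt0 // divr_gt0 // mulr_gt0.
rewrite -/bound -lee_fin in rate.
have level : x_min F + delta < xbar ->
    -1 <= x_min F + delta <= 1 /\ 4 * gamma <= F (x_min F + delta).
  move=> small; split; last exact: fat_level fatF g0 small.
  by have /andP[] := xm1; have /andP[] := xb1; lra.
split=> d T P.
  move=> x Z dx coins indep.
  have inj : injective (@id ('I_(L N) * 'I_N)) by [].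
  apply: le_trans rate.
  apply: (@expected_error _ _ _ P _ Z N (L N) id (fun i _ => x i) eta (h N)
    indep inj Npos eta0 h0 coins _ _ (x_min F) xbar delta set0) => //.
    by rewrite measure0 expR_ge0.
  move=> w _; split; first by move=> i; exact: fixed_data_ge.
  move=> /level[th1 Fth].
  by have := fixed_data_share N2 dF dx th1; rewrite -/gamma; lra.
move=> X Z XF coins indep.
have inj : injective (@inr 'I_N ('I_(L N) * 'I_N)) by move=> i j [].
apply: le_trans rate.
(* The two ways in which the data can be bad: a user below x_min, or too few
   users below x_min + delta. *)
pose early := \bigcup_(i in [set: 'I_N]) [set w | X i w < x_min F].
pose sparse := if x_min F + delta < xbar then
  [set w | share R (below (fun i => X i w) (x_min F + delta)) < 2 * gamma]
  else set0.
have early0 i := cdf_lt_x_min dF xm1 (XF i).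
have mearly : measurable early.
  apply: fin_bigcup_measurable => [|i _]; first exact: finite_finset.
  by have [] := early0 i.
have Pearly : fine (P early) <= 0.
  apply: (@le_trans _ _ (\sum_i fine (P [set w | X i w < x_min F]))).
    apply: prob_union => //; first by move=> i; have [] := early0 i.
    by move=> w [i _ iw]; exists i.
  by rewrite big1 // => i _; have [_ ->] := early0 i.
have [msparse Psparse] : measurable sparse /\
    fine (P sparse) <= expR (- (h N / 4)).
  rewrite /sparse; case: ifPn => [small|_]; last by rewrite measure0 expR_ge0.
  have [th1 Fth] := level small.
  have Fth1 : 4 * threshold N eta (h N) <= F (x_min F + delta) <= 1.
    by rewrite Fth /=; have [/(_ _ th1)/andP[]] := dF.
  exact: (iid_sparse Npos eta0 h0 XF indep th1 Fth1).
apply: (@expected_error _ _ _ P _ (data_and_coins X Z) N (L N) inr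
  (fun i => X i) eta (h N) indep inj Npos eta0 h0 coins _ _ (x_min F) xbar delta
  (early `|` sparse)) => //.
- move=> t i; apply: (@measurable_history _ _ _ _ _ (data_and_coins X Z) _ (inl i)).
  by rewrite inE; apply/negP => /imsetP[].
- exact: measurableU.
- by apply: (le_trans (probU P mearly msparse)); lra.
move=> w /not_orP[ne ns]; split.
  by move=> i; rewrite leNgt; apply/negP => Xi; apply: ne; exists i.
by move=> small; rewrite leNgt; apply/negP => sp; apply: ns; rewrite /sparse small.
Qed.
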